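(* The residual $u(t)=:\overline{u}^{[i]}$, a constant for $t\in[t_{i-1},t_i]$, for all $i=1,\ldots,N$, which solves Problem (PLinf) with $f(x(t),t)=\sqrt{x(t)}$, is given by the implicit equation $$\overline{u}^{[i]}\,\ln\left(\frac{\sqrt{z_i}+\overline{u}^{[i]}}{\sqrt{z_{i-1}}+\overline{u}^{[i]}}\right) = \sqrt{z_i}-\sqrt{z_{i-1}} - \frac{t_i-t_{i-1}}{2}.$$ A corresponding implicit solution for $x(t)$, for all $t\in[t_{i-1},t_i]$, is then $$\sqrt{x(t)} - \overline{u}^{[i]}\,\ln\left(\frac{\sqrt{x(t)} + \overline{u}^{[i]}}{\sqrt{z_{i-1}} + \overline{u}^{[i]}}\right) = \sqrt{z_{i-1}} + \frac{t-t_{i-1}}{2}.$$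
   Context: Let $0=t_0<t_1<\cdots<t_N=:t_f$ and let $z_0=1,z_1,\ldots,z_N>0$ (the skeleton) satisfy $z_i\ne z_{i-1}$, $i=1,\ldots,N$. The underlying ODE is $\dot z(t)=\sqrt{z(t)}$, $z(0)=1$. The interpolant is assumed to satisfy $x(t)>0$ for all $t\in[t_0,t_f]$. Problem (PLinf): minimize $\sum_{i=1}^N\max_{t_{i-1}\le t\le t_i}|u(t)|$ (the maximum over each stage understood as the essential supremum) over (positive) $x\in W^{1,\infty}(t_0,t_f;\mathbb{R})$ and $u\in L^\infty(t_0,t_f;\mathbb{R})$ subject to $\dot x(t)=f(x(t),t)+u(t)$ for a.e. $t\in[t_0,t_f]$ and $x(t_i)=z_i$, $i=0,\ldots,N$. The residual $u=\dot x-f(x,t)$ may jump at the nodes $t_1,\ldots,t_{N-1}$; the formulas are to be read separately on each stage $[t_{i-1},t_i]$. The statement asserts that the solving residual is constant on each stage and that its stage value $\overline u^{[i]}$ and the corresponding $x$ satisfy the displayed equations. *)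

(* Defs.v *)
From HB Require Import structures.
From mathcomp Require Import all_boot all_order all_algebra.
From mathcomp Require Import all_classical all_reals all_analysis.

Set Implicit Arguments.
Unset Strict Implicit.
Unset Printing Implicit Defensive.

Import Order.TTheory GRing.Theory Num.Theory.
Import numFieldNormedType.Exports.

Local Open Scope classical_set_scope.
Local Open Scope ring_scope.

Section defs.
Context {R : realType}.
Implicit Types (a b : R) (t z : nat -> R) (x u v phi : R -> R).
Implicit Types (f : R -> R -> R) (D : set R) (N : nat).

Local Notation mu := (@lebesgue_measure R).

(* The norm of L^oo(D): extending by 0 outside D does not change the
   essential supremum of the absolute value. *)
Definition Linf_norm D u : \bar R := 'N[mu]_(+oo%E)[EFin \o (u \_ D)].

(* Elements of L^oo(D) are represented by functions R -> R whose values
   outside D are irrelevant. *)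
Definition Linf D u := measurable_fun D u /\ (Linf_norm D u < +oo)%E.

(* C^1_c(]a, b[), extended by 0 to R *)
Definition test_function a b phi :=
  [/\ forall s : R, derivable phi s 1, continuous (derive1 phi),
      compact (closure [set s | phi s != 0]) &
      closure [set s | phi s != 0] `<=` `]a, b[ ].

Definition weak_derivative a b x v :=
  forall phi, test_function a b phi ->
    (\int[mu]_(s in `]a, b[) (x s * derive1 phi s) =
     - \int[mu]_(s in `]a, b[) (v s * phi s))%R.

(* x is the continuous representative on [a, b] of an element of
   W^{1,oo}(a, b) whose weak derivative is v; this gives a meaning to the
   point values x(t_i). *)
Definition W1inf_deriv a b x v :=
  [/\ {within `[a, b], continuous x}, Linf `]a, b[ x, Linf `]a, b[ v &
      weak_derivative a b x v].

Definition PLinf_feasible N t z f x u :=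
  [/\ exists2 v, W1inf_deriv (t 0%N) (t N) x v &
        \forall s \ae mu, s \in `[t 0%N, t N] -> v s = f (x s) s + u s,
      Linf `]t 0%N, t N[ u,
      forall s, s \in `[t 0%N, t N] -> 0 < x s &
      forall i, (i <= N)%N -> x (t i) = z i].

(* The term of index i is the stage [t_i, t_{i+1}], i = 0, ..., N - 1. *)
Definition PLinf_cost N t u : \bar R :=
  (\sum_(i < N) Linf_norm `[t i, t i.+1] u)%E.

Definition PLinf_solution N t z f x u :=
  PLinf_feasible N t z f x u /\
  forall y w, PLinf_feasible N t z f y w ->
    (PLinf_cost N t u <= PLinf_cost N t w)%E.

End defs.

(* Main.v *)
(* Along x' = sqrt x + c, put y = sqrt x and k = sqrt z_(i-1) + c, and use the
   parameter th = ln ((y + c) / k).  Then y = sqrt z_(i-1) + k (e^th - 1), and the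
   elapsed time 2 (k (e^th - 1) - c th) has th-derivative 2 y > 0: inverting it
   gives x, and its definition is the implicit equation.  The final value of th,
   hence c, comes from the intermediate value theorem; both signs of
   z_i - z_(i-1) are treated at once.

   On one stage, let |u| <= |c|.  If c >= 0 then u <= c, and if c < 0 then u >= c,
   so u - c has a constant sign.  Two positive trajectories of x' = sqrt x + u
   with ordered residuals and the same values at both ends coincide: their
   difference d satisfies d' <= sqrt x - sqrt y, so that it cannot return to 0
   from below, and it stays nonpositive by Gronwall's inequality.  Hence u = c, so
   that |c| is the least possible stage cost, attained only by the constant.
   Concatenating the stages attains all of these minima at once, so that every
   solution does. *)
Require Import Defs.
From HB Require Import structures.
From mathcomp Require Import all_boot all_order all_algebra.
From mathcomp Require Import all_classical all_reals all_analysis.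
From mathcomp Require Import measurable_realfun ess_sup_inf ring lra.

Set Implicit Arguments.
Unset Strict Implicit.
Unset Printing Implicit Defensive.

Import Order.TTheory GRing.Theory Num.Theory.
Import numFieldNormedType.Exports.

Local Open Scope classical_set_scope.
Local Open Scope ring_scope.

(** * Quadratic splines *)

Section spline.
Context {R : realType}.
Implicit Types r s p q e : R.

(** Written with the absolute value, so that continuity is that of the norm. *)
Definition pos_part r := (r + `|r|) / 2.

Lemma pos_part_ge0 r : 0 <= r -> pos_part r = r.
Proof. by rewrite /pos_part => /ger0_norm ->; field. Qed.

Lemma pos_part_le0 r : r <= 0 -> pos_part r = 0.
Proof. by rewrite /pos_part => /ler0_norm ->; field. Qed.

Lemma continuous_pos_part : continuous pos_part.
Proof.
move=> r; apply: cvgM; last exact: cvg_cst.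
by apply: cvgD; [exact: cvg_id|exact: norm_continuous].
Qed.

Lemma is_derive_sqr_pos_part r :
  is_derive r 1 (fun s => pos_part s ^+ 2) (2 * pos_part r).
Proof.
have [r0|r0|->] := ltgtP r 0.
- apply: (@near_eq_is_derive _ _ _ (cst 0)); last first.
    by rewrite pos_part_le0 ?ltW// mulr0; exact: is_derive_cst.
  near=> s; rewrite pos_part_le0 ?expr0n//; apply: ltW; near: s.
  exact: lt_nbhsl.
- apply: (@near_eq_is_derive _ _ _ (fun s => s ^+ 2)); last first.
    apply: is_derive_eq; rewrite pos_part_ge0 ?ltW//.
    by rewrite /GRing.scale/=; ring.
  near=> s; rewrite pos_part_ge0//; apply: ltW; near: s.
  exact: lt_nbhsr.
(* At 0 the slope function is [pos_part] itself, since [pos_part s ^+ 2 = pos_part s * s]. *)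
- apply/is_derive1_caratheodory; exists pos_part; split.
  + move=> s; rewrite (@pos_part_ge0 0)//.
    have [s0|/ltW s0] := lerP 0 s; first by rewrite pos_part_ge0//; ring.
    by rewrite pos_part_le0//; ring.
  + exact: continuous_pos_part.
  + by rewrite pos_part_ge0// mulr0.
Unshelve. all: by end_near. Qed.

(** The linear B-spline with knots 0, 1, 2, as a second difference. *)
Definition hat r := pos_part r - 2 * pos_part (r - 1) + pos_part (r - 2).

(** The antiderivative of [hat] that vanishes on the left: a $C^1$ transition from 0 to 1 over
    [0, 2]. Quadratic pieces are smooth enough, as test functions are only $C^1$. *)
Definition smoothstep r :=
  (pos_part r ^+ 2 - 2 * pos_part (r - 1) ^+ 2 + pos_part (r - 2) ^+ 2) / 2.

Variant hat_spec r : R -> R -> Type :=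
| HatLe0 of r <= 0 : hat_spec r 0 0
| HatLe1 of 0 <= r <= 1 : hat_spec r r (r ^+ 2 / 2)
| HatLe2 of 1 <= r <= 2 : hat_spec r (2 - r) (1 - (2 - r) ^+ 2 / 2)
| HatGe2 of 2 <= r : hat_spec r 0 1.

Lemma hatP r : hat_spec r (hat r) (smoothstep r).
Proof.
rewrite /hat /smoothstep.
have [r0|/ltW r0] := lerP r 0.
  rewrite !pos_part_le0; [|lra..].
  rewrite (_ : 0 - _ + _ = 0); last by ring.
  rewrite (_ : _ / 2 = 0); last by ring.
  exact: HatLe0.
have [r1|/ltW r1] := lerP r 1.
  rewrite (pos_part_ge0 r0) !pos_part_le0; [|lra..].
  rewrite (_ : r - _ + _ = r); last by ring.
  rewrite (_ : _ / 2 = r ^+ 2 / 2); last by ring.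
  by apply: HatLe1; rewrite r0.
have [r2|/ltW r2] := lerP r 2.
  rewrite (pos_part_ge0 r0) (@pos_part_ge0 (r - 1)) ?(@pos_part_le0 (r - 2)); [|lra..].
  rewrite (_ : r - _ + _ = 2 - r); last by ring.
  rewrite (_ : _ / 2 = 1 - (2 - r) ^+ 2 / 2); last by field.
  by apply: HatLe2; rewrite r1.
rewrite !pos_part_ge0; [|lra..].
rewrite (_ : r - _ + _ = 0); last by ring.
rewrite (_ : _ / 2 = 1); last by field.
exact: HatGe2.
Qed.

Lemma hat_ge0 r : 0 <= hat r.
Proof. by case: hatP => //; lra. Qed.

Lemma hat_neq0 r : hat r != 0 -> 0 <= r <= 2.
Proof. by case: hatP; rewrite ?eqxx// => *; lra. Qed.

Lemma smoothstep_itv01 r : 0 <= smoothstep r <= 1.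
Proof. by case: hatP => // *; nra. Qed.

Lemma smoothstep_le0 r : r <= 0 -> smoothstep r = 0.
Proof.
by move=> r0; rewrite /smoothstep !pos_part_le0; [ring|lra..].
Qed.

Lemma smoothstep_ge2 r : 2 <= r -> smoothstep r = 1.
Proof.
by move=> r2; rewrite /smoothstep !pos_part_ge0; [field|lra..].
Qed.

Lemma continuous_hat : continuous hat.
Proof.
move=> r.
have c k : (fun s => pos_part (s - k)) x @[x --> r] --> pos_part (r - k).
  apply: (@continuous_comp _ _ _ (fun s => s - k) pos_part).
    by apply: cvgB; [exact: cvg_id|exact: cvg_cst].
  exact: continuous_pos_part.
apply: cvgD; last exact: c.
apply: cvgB; first exact: continuous_pos_part.
by apply: cvgM; [exact: cvg_cst|exact: c].
Qed.

Lemma is_derive_smoothstep r : is_derive r 1 smoothstep (hat r).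
Proof.
have d k : is_derive r 1 (fun s => pos_part (s - k) ^+ 2) (2 * pos_part (r - k)).
  rewrite -[2 * _]mulr1.
  apply: (@is_derive1_comp _ (fun s => pos_part s ^+ 2) (fun s => s - k)).
    exact: is_derive_sqr_pos_part.
  by apply: is_derive_eq; rewrite subr0.
have d0 := is_derive_sqr_pos_part r.
have d1 := d 1.
have d2 := d 2.
rewrite (_ : smoothstep = (2^-1 *: ((fun s => pos_part s ^+ 2) -
   2 *: (fun s => pos_part (s - 1) ^+ 2) + (fun s => pos_part (s - 2) ^+ 2)))).
  by apply: is_derive_eq; rewrite /hat /GRing.scale/=; field.
by apply: funext => s; rewrite /smoothstep /GRing.scale/= mulrC.
Qed.

End spline.

(** * Test functions with trapezoidal profile *)

Section trapezoid.
Context {R : realType}.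
Local Notation mu := (@lebesgue_measure R).
Implicit Types (a b c p q e s : R) (x v : R -> R).

(** For e > 0, [hat] rescaled to unit mass on [p, p + 2 e]: an approximate Dirac mass. *)
Definition bump p e s := hat ((s - p) / e) / e.

(** The derivative is a difference of two bumps, so that testing a weak derivative on it compares
    averages of x near p and near q. *)
Definition trapezoid p q e s :=
  smoothstep ((s - p) / e) - smoothstep ((s - q) / e).

Lemma continuous_bump p e : continuous (bump p e).
Proof.
move=> s; apply: cvgM; last exact: cvg_cst.
apply: (@continuous_comp _ _ _ (fun s => (s - p) / e) hat); last exact: continuous_hat.
apply: cvgM; last exact: cvg_cst.
by apply: cvgB; [exact: cvg_id|exact: cvg_cst].
Qed.

Lemma bump_ge0 p e s : 0 < e -> 0 <= bump p e s.
Proof. by move=> e0; rewrite divr_ge0 ?hat_ge0 ?ltW. Qed.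

Lemma bump_neq0 p e s : 0 < e -> bump p e s != 0 -> p <= s <= p + 2 * e.
Proof.
move=> e0; rewrite /bump mulf_eq0 negb_or => /andP[/hat_neq0 + _].
by rewrite ler_pdivlMr// ler_pdivrMr// mul0r; lra.
Qed.

Lemma is_derive_smoothstep_affine p e s :
  is_derive s 1 (fun s => smoothstep ((s - p) / e)) (bump p e s).
Proof.
apply: (@is_derive1_comp _ smoothstep (fun s => (s - p) / e)).
  exact: is_derive_smoothstep.
rewrite (_ : (fun s => (s - p) / e) = e^-1 *: (fun s => s - p)).
  by apply: is_derive_eq; rewrite /GRing.scale/= subr0 mulr1.
by apply: funext => r; rewrite /GRing.scale/= mulrC.
Qed.

Lemma is_derive_trapezoid p q e s :
  is_derive s 1 (trapezoid p q e) (bump p e s - bump q e s).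
Proof.
have d1 := is_derive_smoothstep_affine p e s.
have d2 := is_derive_smoothstep_affine q e s.
exact: is_deriveB.
Qed.

Lemma derive1_trapezoid p q e :
  derive1 (trapezoid p q e) = (fun s => bump p e s - bump q e s).
Proof.
apply: funext => s; rewrite derive1E.
by have [_ ->] := is_derive_trapezoid p q e s.
Qed.

Lemma trapezoid_itv01 p q e s : 0 < e -> p + 2 * e <= q ->
  0 <= trapezoid p q e s <= 1.
Proof.
move=> e0 pq; rewrite /trapezoid.
have [sq|/ltW qs] := lerP s q.
  rewrite (@smoothstep_le0 _ ((s - q) / e)) ?subr0 ?smoothstep_itv01//.
  by rewrite ler_pdivrMr// mul0r; lra.
rewrite (@smoothstep_ge2 _ ((s - p) / e)); last by rewrite ler_pdivlMr//; lra.
by have := smoothstep_itv01 ((s - q) / e); lra.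
Qed.

Lemma trapezoid_eq1 p q e s : 0 < e -> p + 2 * e <= s <= q ->
  trapezoid p q e s = 1.
Proof.
move=> e0 /andP[ps sq]; rewrite /trapezoid smoothstep_ge2 ?smoothstep_le0 ?subr0//.
  by rewrite ler_pdivrMr// mul0r; lra.
by rewrite ler_pdivlMr//; lra.
Qed.

Lemma trapezoid_eq0 p q e s : 0 < e -> p <= q -> s <= p \/ q + 2 * e <= s ->
  trapezoid p q e s = 0.
Proof.
move=> e0 pq [sp|qs]; rewrite /trapezoid.
  by rewrite !smoothstep_le0 ?subr0// ler_pdivrMr// mul0r; lra.
by rewrite !smoothstep_ge2 ?subrr// ler_pdivlMr//; lra.
Qed.

Lemma test_function_trapezoid a b p q e : 0 < e -> a < p -> p <= q ->
  q + 2 * e < b -> test_function a b (trapezoid p q e).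
Proof.
move=> e0 ap pq qb.
have supp : closure [set s | trapezoid p q e s != 0] `<=` `[p, q + 2 * e].
  rewrite closureE; apply: smallest_sub; first exact: interval_closed.
  move=> s /= nz; rewrite in_itv/=; apply/andP; split; rewrite leNgt;
  apply: contraNN nz => h; apply/eqP; apply: trapezoid_eq0 => //.
  - by left; exact: ltW.
  - by right; exact: ltW.
split.
- by move=> s; have [] := is_derive_trapezoid p q e s.
- rewrite derive1_trapezoid => s.
  by apply: cvgB; exact: continuous_bump.
- apply: (subclosed_compact (@closed_closure _ _) _ supp).
  exact: segment_compact.
- move=> s /supp /=; rewrite !in_itv/= => /andP[ps sq]; apply/andP; split.
    exact: lt_le_trans ps.
  exact: le_lt_trans qb.
Qed.

Lemma integrable_within_continuous a b x : {within `[a, b], continuous x} ->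
  mu.-integrable `]a, b[ (EFin \o x).
Proof.
move=> cx; have : mu.-integrable `[a, b] (EFin \o x).
  apply: continuous_compact_integrable => //.
  exact: segment_compact.
apply: integrableS => //.
exact: subset_itv_oo_cc.
Qed.

Lemma Rintegral_bump a b p e : 0 < e -> a <= p -> p + 2 * e <= b ->
  \int[mu]_(s in `]a, b[) bump p e s = 1.
Proof.
move=> e0 ap pb.
have ab : a < b by apply: le_lt_trans ap _; apply: lt_le_trans pb; lra.
have cb : {within `[a, b], continuous (bump p e)}.
  exact/continuous_subspaceT/continuous_bump.
have d s := is_derive_smoothstep_affine p e s.
have cs : continuous (fun s => smoothstep ((s - p) / e)).
  move=> s; apply: differentiable_continuous; rewrite -derivable1_diffP.
  by have [] := d s.
rewrite /Rintegral.
have <- := @integral_itv_bndoo _ a b (EFin \o bump p e) true false _; last first.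
  exact: measurable_int (integrable_within_continuous cb).
rewrite (@continuous_FTC2 _ (bump p e) (fun s => smoothstep ((s - p) / e)))//.
- rewrite smoothstep_ge2 ?smoothstep_le0/= ?subr0//.
    by rewrite ler_pdivrMr// mul0r; lra.
  by rewrite ler_pdivlMr//; lra.
- split.
  + by move=> s _; have [] := d s.
  + exact/cvg_at_right_filter/cs.
  + exact/cvg_at_left_filter/cs.
- by move=> s _; rewrite derive1E; have [_ ->] := d s.
Qed.

(** The weight is nonnegative with integral 1, so c is the integral of c times the weight, and the
    bounds on the support can be integrated. *)
Lemma bump_average a b p e x c eta : 0 < e -> a <= p -> p + 2 * e <= b ->
    {within `[a, b], continuous x} ->
    (forall s, p <= s <= p + 2 * e -> `|x s - c| <= eta) ->
  `|\int[mu]_(s in `]a, b[) (x s * bump p e s) - c| <= eta.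
Proof.
move=> e0 ap pb cx xc.
have cb : {within `[a, b], continuous (bump p e)}.
  exact/continuous_subspaceT/continuous_bump.
have ib : mu.-integrable `]a, b[ (EFin \o bump p e).
  exact: integrable_within_continuous.
have ixb : mu.-integrable `]a, b[ (EFin \o (fun s => x s * bump p e s)).
  apply: integrable_within_continuous => s.
  by apply: cvgM; [exact: cx|exact: cb].
have ik k : mu.-integrable `]a, b[ (EFin \o (fun s => k * bump p e s)).
  apply: integrable_within_continuous => s.
  by apply: cvgM; [exact: cvg_cst|exact: cb].
have eqk k : \int[mu]_(s in `]a, b[) (k * bump p e s) = k.
  by rewrite RintegralZl// Rintegral_bump// mulr1.
rewrite ler_norml; apply/andP; split.
  rewrite lerBrDr addrC -[leLHS]eqk; apply: le_Rintegral => // s _.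
  have [->|/(bump_neq0 e0)/xc] := eqVneq (bump p e s) 0; first by rewrite !mulr0.
  rewrite ler_norml => /andP[h _]; rewrite ler_wpM2r ?bump_ge0//; lra.
rewrite lerBlDr addrC -[leRHS]eqk; apply: le_Rintegral => // s _.
have [->|/(bump_neq0 e0)/xc] := eqVneq (bump p e s) 0; first by rewrite !mulr0.
by rewrite ler_norml => /andP[_ h]; rewrite ler_wpM2r ?bump_ge0//; lra.
Qed.

End trapezoid.

(** * From weak derivatives to integral increments *)

Section weak_derivative.
Context {R : realType}.
Local Notation mu := (@lebesgue_measure R).
Implicit Types (a b p q s : R) (x v : R -> R).

Lemma within_continuous_dist a b x p eta : {within `[a, b], continuous x} ->
  a <= p <= b -> 0 < eta ->
  exists2 d, 0 < d &
    forall s, a <= s <= b -> `|s - p| < d -> `|x s - x p| <= eta.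
Proof.
move=> /subspace_continuousP cx pab eta0.
have /cvgrPdist_le/(_ _ eta0) : x s @[s --> within `[a, b] (nbhs p)] --> x p.
  by apply: cx; rewrite /= in_itv.
rewrite near_withinE => /nbhs_ballP[d /= d0 h]; exists d => // s sab sp.
rewrite distrC; apply: h; last by rewrite /= in_itv.
by rewrite /ball/= distrC.
Qed.

(** The supports shrink to p, where x is continuous. The factor 3 fits both uses: supports from p +
    e to p + 3 e, and from q - 3 e to q - e. *)
Lemma cvg_bump_average a b x p (P e : nat -> R) :
    {within `[a, b], continuous x} -> a <= p <= b ->
    (forall n, [/\ 0 < e n, a <= P n & P n + 2 * e n <= b]) ->
    (forall n s, P n <= s <= P n + 2 * e n -> `|s - p| <= 3 * e n) ->
    e n @[n --> \oo] --> 0 ->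
  \int[mu]_(s in `]a, b[) (x s * bump (P n) (e n) s) @[n --> \oo] --> x p.
Proof.
move=> cx pab eP Pp e0; apply/cvgrPdist_le => eta eta0.
have [d d0 xd] := within_continuous_dist cx pab eta0.
have d3 : 0 < d / 3 by rewrite divr_gt0.
move/cvgrPdist_lt : e0 => /(_ _ d3) [N _ eN].
exists N => // n Nn /=; rewrite distrC.
have [en aP Pb] := eP n.
apply: bump_average => // s sP; apply: xd; first by lra.
have := eN _ Nn; rewrite sub0r normrN gtr0_norm// => end3.
by apply: le_lt_trans (Pp _ _ sP) _; lra.
Qed.

(** The weak identity is tested on trapezoids that tend to the indicator of ]p, q[. The terms in x
    converge by continuity to its values at p and q, the term in v by dominated convergence. *)
Lemma weak_derivative_increment a b x v : {within `[a, b], continuous x} ->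
    mu.-integrable `]a, b[ (EFin \o v) -> weak_derivative a b x v ->
  forall p q, a <= p -> p <= q -> q <= b ->
  x q - x p = \int[mu]_(s in `]p, q[) v s.
Proof.
move=> cx iv wv p q ap; rewrite le_eqVlt => /predU1P[<- _|pq qb].
  by rewrite set_itv_ge ?bnd_simp ?ltxx// Rintegral_set0 subrr.
(* Trapezoids rising on [p + e, p + 3 e] and falling on [q - 3 e, q - e]: their
   support is inside ]a, b[ even if p = a or q = b. *)
pose e n : R := (q - p) / 6 * n.+1%:R^-1.
have e_gt0 n : 0 < e n by rewrite mulr_gt0// divr_gt0// subr_gt0.
have e_le n : 6 * e n <= q - p.
  have : n.+1%:R^-1 <= 1 :> R by rewrite invf_le1 ?ltr0Sn// ler1n.
  by rewrite /e; move: (_^-1) => k k1; nra.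
have e0 : e n @[n --> \oo] --> 0.
  rewrite -(mulr0 ((q - p) / 6)); apply: cvgMr.
  exact: cvg_harmonic.
pose P n := p + e n.
pose Q n := q - 3 * e n.
have PQ n : P n + 2 * e n <= Q n by have := e_le n; rewrite /P /Q; lra.
pose phi n := trapezoid (P n) (Q n) (e n).
have phitest n : test_function a b (phi n).
  have en := e_gt0 n; have len := e_le n.
  by apply: test_function_trapezoid; rewrite // /P /Q; lra.
have cvgP : \int[mu]_(s in `]a, b[) (x s * bump (P n) (e n) s) @[n --> \oo] --> x p.
  apply: cvg_bump_average => //; first by lra.
    move=> n; have en := e_gt0 n; have len := e_le n.
    by split; rewrite // /P; lra.
  move=> n s; have en := e_gt0 n; rewrite /P => h.
  by rewrite ger0_norm; lra.
have cvgQ : \int[mu]_(s in `]a, b[) (x s * bump (Q n) (e n) s) @[n --> \oo] --> x q.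
  apply: cvg_bump_average => //; first by lra.
    move=> n; have en := e_gt0 n; have len := e_le n.
    by split; rewrite // /Q; lra.
  move=> n s; have en := e_gt0 n; rewrite /Q => h.
  by rewrite ler0_norm; lra.
have ixb r k : mu.-integrable `]a, b[ (EFin \o (fun s => x s * bump r k s)).
  apply: integrable_within_continuous => s; apply: cvgM; first exact: cx.
  exact/continuous_subspaceT/continuous_bump.
have weak n : \int[mu]_(s in `]a, b[) (v s * phi n s) =
    \int[mu]_(s in `]a, b[) (x s * bump (Q n) (e n) s) -
    \int[mu]_(s in `]a, b[) (x s * bump (P n) (e n) s).
  have := wv _ (phitest n); rewrite derive1_trapezoid.
  under eq_Rintegral do rewrite mulrBr.
  by rewrite RintegralB// => /eqP; rewrite -eqr_oppLR => /eqP <-; rewrite opprB.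
have cphi n : continuous (phi n).
  move=> s; apply: differentiable_continuous; rewrite -derivable1_diffP.
  by have [] := phitest n.
have mphi n : measurable_fun `]a, b[ (phi n).
  have /integrable_within_continuous/measurable_int/measurable_EFinP// :
    {within `[a, b], continuous (phi n)}.
  exact/continuous_subspaceT/cphi.
have mv : measurable_fun `]a, b[ v by have /measurable_int/measurable_EFinP := iv.
have phi01 n s : 0 <= phi n s <= 1 by exact: trapezoid_itv01.
have Hf_ n : measurable_fun `]a, b[ (EFin \o (fun s => v s * phi n s)).
  by apply/measurable_EFinP/measurable_funM.
have Hf : measurable_fun `]a, b[ (EFin \o (v \_ `]p, q[)).
  apply/measurable_EFinP/measurable_restrict => //.
  by apply: measurable_funS mv => // s [].
have Hcvg : \forall s \ae mu, `]a, b[%classic s ->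
    (v s * phi n s)%:E @[n --> \oo] --> (EFin \o (v \_ `]p, q[)) s.
  apply: nearW => s _; apply: cvg_EFin; first exact: nearW.
  (* At each point the sequence is eventually constant: [phi n s] is 1 for large n if s is in ]p,
     q[, and 0 for every n otherwise. *)
  apply: cvg_near_cst; rewrite /= patchE; case: ifPn => [|spq].
    rewrite inE/= in_itv/= => /andP[ps sq].
    pose d := Num.min (s - p) (q - s) / 3.
    have d0 : 0 < d by rewrite divr_gt0// lt_min; apply/andP; split; lra.
    have dp : 3 * d <= s - p by rewrite /d mulrC divfK// ge_min lexx.
    have dq : 3 * d <= q - s by rewrite /d mulrC divfK// ge_min lexx orbT.
    move/cvgrPdist_lt : e0 => /(_ _ d0) [N _ eN].
    exists N => // n Nn /=.
    have := eN _ Nn; rewrite sub0r normrN gtr0_norm// => end3.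
    apply/eqP; rewrite /phi trapezoid_eq1 ?mulr1//.
    by rewrite /P /Q; lra.
  apply: nearW => n; apply/eqP; rewrite /phi trapezoid_eq0 ?mulr0//.
    by have := PQ n; have := e_gt0 n; lra.
  move: spq; rewrite notin_setE/= in_itv/= => /negP; rewrite negb_and -!leNgt.
  have en := e_gt0 n.
  by move=> /orP[sp|qs]; [left|right]; rewrite /P /Q; lra.
have Hg : mu.-integrable `]a, b[ (EFin \o (Num.norm \o v)).
  exact: integrable_abse iv.
have Hfg : \forall s \ae mu, forall n, `]a, b[%classic s ->
    (`|(v s * phi n s)%:E| <= (EFin \o (Num.norm \o v)) s)%E.
  apply: nearW => s n _; rewrite /= lee_fin normrM ler_piMr//.
  by rewrite ger0_norm; have := phi01 n s; lra.
have [iv' _] := @dominated_convergence _ _ _ mu _ (measurable_itv _)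
  (fun n => EFin \o (fun s => v s * phi n s)) _ _ Hf_ Hf Hcvg Hg Hfg.
rewrite -[X in _ --> X]fineK; last exact: integrable_fin_num.
move=> /fine_cvg cvgI.
have vpq : fine (\int[mu]_(s in `]a, b[) (EFin \o (v \_ `]p, q[)) s)%E =
    \int[mu]_(s in `]p, q[) v s.
  rewrite -/(Rintegral mu _ (v \_ _)) -Rintegral_mkcondr setIidr//.
  by apply: subset_itv; rewrite bnd_simp.
apply: cvg_unique (cvgB cvgQ cvgP) _; first exact: norm_hausdorff.
rewrite -vpq; apply: cvg_trans cvgI; apply: near_eq_cvg; apply: nearW => n.
exact: weak.
Qed.

End weak_derivative.

(** * Comparison of trajectories *)

Section Rintegral_ae.
Context d (T : measurableType d) {R : realType}.
Variable mu : {measure set T -> \bar R}.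
Implicit Types (D : set T) (f g : T -> R).

Lemma ae_eq_Rintegral D f g : measurable D ->
    measurable_fun D f -> measurable_fun D g ->
    (\forall x \ae mu, D x -> f x = g x) ->
  \int[mu]_(x in D) f x = \int[mu]_(x in D) g x.
Proof.
move=> mD mf mg fg; congr fine; apply: ae_eq_integral => //.
- exact/measurable_EFinP.
- exact/measurable_EFinP.
- by apply: filterS fg => x h Dx; rewrite h.
Qed.

(** Passing to the absolute value turns a sign known almost everywhere into one that holds at every
    point, as [Rintegral_ge0] and [ae_eq_integral_abs] want it. *)
Lemma ae_ge0_Rintegral D g : measurable D -> mu.-integrable D (EFin \o g) ->
    (\forall x \ae mu, D x -> 0 <= g x) ->
  \int[mu]_(x in D) g x = \int[mu]_(x in D) `|g x|.
Proof.
move=> mD ig g0; have /measurable_int/measurable_EFinP mg := ig.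
apply: ae_eq_Rintegral => //; first exact: measurableT_comp.
by apply: filterS g0 => x h Dx; rewrite ger0_norm ?h.
Qed.

Lemma ae_ge0_Rintegral_eq0 D g : measurable D -> mu.-integrable D (EFin \o g) ->
    (\forall x \ae mu, D x -> 0 <= g x) -> \int[mu]_(x in D) g x = 0 ->
  \forall x \ae mu, D x -> g x = 0.
Proof.
move=> mD ig g0; rewrite ae_ge0_Rintegral// => g_eq0.
have /measurable_int mg := ig.
suff : ae_eq mu D (EFin \o g) (cst 0%E).
  by apply: filterS => x /= h Dx; have [] := h Dx.
apply/ae_eq_integral_abs => //.
rewrite -[LHS]fineK; first by congr EFin.
by have := integrable_abse ig; exact: integrable_fin_num.
Qed.

End Rintegral_ae.

Section comparison.
Context {R : realType}.
Local Notation mu := (@lebesgue_measure R).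
Implicit Types (a b p q s : R) (x y u w f : R -> R).

(* The filter instance of [almost_everywhere] is not inferred for the
   Lebesgue measure of R. *)
Lemma ae_sub (P Q : R -> Prop) : P `<=` Q ->
  (\forall s \ae mu, P s) -> \forall s \ae mu, Q s.
Proof. by move=> PQ; apply: (@filterS _ _ (ae_filter_ringOfSetsType _)). Qed.

Lemma ae_sub2 (P Q S : R -> Prop) : (forall s, P s -> Q s -> S s) ->
  (\forall s \ae mu, P s) -> (\forall s \ae mu, Q s) -> \forall s \ae mu, S s.
Proof. by move=> PQS; apply: (@filterS2 _ _ (ae_filter_ringOfSetsType _)). Qed.

(** c is the least element of the compact set [A] where f is nonnegative. If f c were positive, the
    intermediate value theorem on [a, c] would give a zero before c. *)
Lemma first_zero a b f : a <= b -> {within `[a, b], continuous f} ->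
    f a < 0 -> 0 <= f b ->
  exists c, [/\ a <= c <= b, f c = 0 & forall s, a <= s < c -> f s < 0].
Proof.
move=> ab cf fa fb.
pose A := `[a, b] `&` f @^-1` [set r | 0 <= r].
have clA : closed A.
  have /continuous_closedP/(_ [set r | 0 <= r] (@closed_ge _ 0)) := cf.
  move=> /closed_subspaceP[V cV]; rewrite [in X in _ = X]setIC => VA.
  rewrite /A -VA; apply: closedI => //; exact: interval_closed.
have cA : compact A.
  by apply: subclosed_compact clA (@segment_compact _ a b) _ => s [].
have A0 : A !=set0 by exists b; split => //=; rewrite in_itv/= ab lexx.
have ci : {within A, continuous (@id R)}.
  by apply: continuous_subspaceT => s; exact: cvg_id.
have [c] := compact_EVT_min A0 cA ci.
rewrite inE => -[/= + fc] cmin; rewrite in_itv/= => cab.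
exists c; split => //; last first.
  move=> s /andP[as_ sc]; rewrite ltNge; apply/negP => fs.
  suff : c <= s by rewrite leNgt sc.
  apply: cmin; rewrite inE; split => //=; rewrite in_itv/= as_/=.
  by case/andP: cab => _; apply: le_trans; exact: ltW.
apply/eqP; rewrite eq_le fc andbT leNgt; apply/negP => fc0.
have cf' : {within `[a, c], continuous f}.
  apply: continuous_subspaceW cf; apply: subset_itvl.
  by rewrite bnd_simp; case/andP: cab.
have [|e] := @IVT _ f a c 0 (proj1 (andP cab)) cf'.
  by rewrite ge_min le_max (ltW fa) fc orbT.
rewrite in_itv/= => /andP[ae ec] fe.
have : c <= e.
  apply: cmin; rewrite inE; split => /=; last by rewrite fe.
  by rewrite in_itv/= ae (le_trans ec)//; case/andP: cab.
rewrite le_eqVlt => /predU1P[ce|]; last by rewrite ltNge ec.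
by move: fc0; rewrite ce fe ltxx.
Qed.

Lemma Rintegral_expR a b k : a <= b ->
  \int[mu]_(s in `]a, b[) (k * expR (k * s)) = expR (k * b) - expR (k * a).
Proof.
rewrite le_eqVlt => /predU1P[<-|ab].
  by rewrite set_itv_ge ?bnd_simp ?ltxx// Rintegral_set0 subrr.
have d s : is_derive s 1 (fun s => expR (k * s)) (k * expR (k * s)).
  rewrite mulrC; apply: (@is_derive1_comp _ expR (fun s => k * s)).
  by apply: is_derive_eq; rewrite /GRing.scale/= mulr1.
have c : continuous (fun s => expR (k * s)).
  move=> s; apply: differentiable_continuous; rewrite -derivable1_diffP.
  by have [] := d s.
have ck : {within `[a, b], continuous (fun s => k * expR (k * s))}.
  apply: continuous_subspaceT => s; apply: cvgM; first exact: cvg_cst.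
  exact: c.
rewrite /Rintegral.
have <- := @integral_itv_bndoo _ a b
  (EFin \o (fun s => k * expR (k * s))) true false _; last first.
  exact: measurable_int (integrable_within_continuous ck).
rewrite (@continuous_FTC2 _ _ (fun s => expR (k * s)))//.
- split.
  + by move=> s _; have [] := d s.
  + exact/cvg_at_right_filter/c.
  + exact/cvg_at_left_filter/c.
- by move=> s _; rewrite derive1E; have [_ ->] := d s.
Qed.

(** x - y factors as the difference times the sum of the roots, and the sum is at least
    [Num.sqrt m]. *)
Lemma sqrt_lipschitz (m x y : R) : 0 < m -> m <= x -> 0 <= y <= x ->
  Num.sqrt x - Num.sqrt y <= (Num.sqrt m)^-1 * (x - y).
Proof.
Proof.
move=> m0 mx /andP[y0 yx].
have sm0 : 0 < Num.sqrt m by rewrite sqrtr_gt0.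
have smx : Num.sqrt m <= Num.sqrt x by rewrite ler_wsqrtr.
have syx : Num.sqrt y <= Num.sqrt x by rewrite ler_wsqrtr.
have sy0 : 0 <= Num.sqrt y by rewrite sqrtr_ge0.
have -> : x - y = Num.sqrt x ^+ 2 - Num.sqrt y ^+ 2.
  by rewrite !sqr_sqrtr// (le_trans y0).
rewrite mulrC ler_pdivlMr// subr_sqr; nra.
Qed.

Lemma comparison a b x y u w : a < b ->
    {within `[a, b], continuous x} -> {within `[a, b], continuous y} ->
    (forall s, a <= s <= b -> 0 < x s) -> (forall s, a <= s <= b -> 0 < y s) ->
    mu.-integrable `]a, b[ (EFin \o u) -> mu.-integrable `]a, b[ (EFin \o w) ->
    (forall p q, a <= p -> p <= q -> q <= b ->
      x q - x p = \int[mu]_(s in `]p, q[) (Num.sqrt (x s) + u s)) ->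
    (forall p q, a <= p -> p <= q -> q <= b ->
      y q - y p = \int[mu]_(s in `]p, q[) (Num.sqrt (y s) + w s)) ->
    (\forall s \ae mu, `]a, b[%classic s -> u s <= w s) ->
    x a = y a -> x b = y b ->
  (forall s, a <= s <= b -> x s = y s) /\
  (\forall s \ae mu, `]a, b[%classic s -> u s = w s).
Proof.
move=> ab cx cy x0 y0 iu iw hx hy uw xya xyb.
have csqrt f : {within `[a, b], continuous f} ->
    {within `[a, b], continuous (fun s => Num.sqrt (f s))}.
  move=> cf s; apply: (continuous_comp (cf s)); exact: sqrt_continuous.
pose d s := x s - y s.
have cd : {within `[a, b], continuous d}.
  by move=> s; apply: cvgB; [exact: cx|exact: cy].
have sub p q : a <= p -> q <= b -> `]p, q[ `<=` `]a, b[.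
  by move=> ap qb; apply: subset_itv; rewrite bnd_simp.
have sint p q f : a <= p -> q <= b -> mu.-integrable `]a, b[ (EFin \o f) ->
    mu.-integrable `]p, q[ (EFin \o f).
  by move=> ap qb; apply: integrableS => //; exact: sub.
have cint p q f : a <= p -> q <= b -> {within `[a, b], continuous f} ->
    mu.-integrable `]p, q[ (EFin \o f).
  by move=> ap qb cf; apply: sint => //; exact: integrable_within_continuous.
have wu_ge0 p q : a <= p -> q <= b ->
    \forall s \ae mu, `]p, q[%classic s -> 0 <= w s - u s.
  move=> ap qb; apply: ae_sub uw => s h spq.
  by rewrite subr_ge0 h//; exact: sub spq.
have iwu : mu.-integrable `]a, b[ (EFin \o (fun s => w s - u s)).
  exact: (integrableB _ iw iu).
(* The integrated form of d' = (sqrt x - sqrt y) - (w - u), where w - u is nonnegative almost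
   everywhere. *)
have K p q : a <= p -> p <= q -> q <= b -> d q - d p =
    \int[mu]_(s in `]p, q[) (Num.sqrt (x s) - Num.sqrt (y s)) -
    \int[mu]_(s in `]p, q[) (w s - u s).
  move=> ap pq qb.
  have isx := cint p q _ ap qb (csqrt x cx).
  have isy := cint p q _ ap qb (csqrt y cy).
  have iu' := sint p q _ ap qb iu; have iw' := sint p q _ ap qb iw.
  have -> : d q - d p = (x q - x p) - (y q - y p) by rewrite /d; ring.
  by rewrite hx// hy// !RintegralB// !RintegralD//; ring.
have Kle p q : a <= p -> p <= q -> q <= b -> d q - d p <=
    \int[mu]_(s in `]p, q[) (Num.sqrt (x s) - Num.sqrt (y s)).
  move=> ap pq qb; rewrite K// gerBl ae_ge0_Rintegral//.
  - exact: Rintegral_ge0.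
  - exact: sint.
  - exact: wu_ge0.
(* If d s < 0, let c be the first zero of d after s, which exists because d b = 0. On ]s, c[ one has
   x < y, so [Kle] bounds the increment - d s by the integral of a nonpositive function: a
   contradiction. *)
have d_ge0 s : a <= s <= b -> 0 <= d s.
  move=> /andP[as_ sb]; rewrite leNgt; apply/negP => ds.
  have cds : {within `[s, b], continuous d}.
    by apply: continuous_subspaceW cd; apply: subset_itv; rewrite bnd_simp.
  have [|c [/andP[sc cb] dc dneg]] := first_zero sb cds ds.
    by rewrite /d xyb subrr.
  have := Kle s c as_ sc cb; rewrite dc sub0r => h.
  have : \int[mu]_(r in `]s, c[) (Num.sqrt (x r) - Num.sqrt (y r)) <=
      \int[mu]_(r in `]s, c[) 0.
    apply: le_Rintegral => //.
    - apply: cint => // r; apply: cvgB; exact: csqrt.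
    - apply: cint => // r; exact: cvg_cst.
    - move=> r /=; rewrite in_itv/= => /andP[sr rc].
      rewrite subr_le0 ler_wsqrtr// -subr_le0; apply/ltW/dneg.
      by rewrite rc ltW.
  rewrite Rintegral_cst// mul0r => h'.
  by move: ds; rewrite ltNge -oppr_le0 (le_trans h h').
(* The square root is not Lipschitz at 0; the minimum of x keeps x away from it. *)
have [m [m0 mx]] : exists m, 0 < m /\ forall s, a <= s <= b -> m <= x s.
  have [c cab cmin] := EVT_min (ltW ab) cx.
  exists (x c); split; first by apply: x0; rewrite in_itv in cab.
  by move=> s sab; apply: cmin; rewrite in_itv.
pose L := (Num.sqrt m)^-1.
have L0 : 0 < L by rewrite invr_gt0 sqrtr_gt0.
have d_le0 s : a <= s <= b -> d s <= 0.
  (* Gronwall: evaluate d <= \int L d at the maximum D of d e^(-2 L s), where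
     d <= D e^(2 L s) gives D E <= D (E - E a) / 2. *)
  pose E s := expR (2 * L * s).
  have cE : {within `[a, b], continuous E}.
    apply: continuous_subspaceT => r.
    apply: (@continuous_comp _ _ _ (fun s => 2 * L * s) expR).
      by apply: cvgM; [exact: cvg_cst|exact: cvg_id].
    exact: continuous_expR.
  have cdE : {within `[a, b], continuous (fun s => d s / E s)}.
    move=> r; apply: cvgM; first exact: cd.
    apply: cvgV; first by rewrite gt_eqF// expR_gt0.
    exact: cE.
  have [c + cmax] := EVT_max (ltW ab) cdE.
  rewrite in_itv/= => /andP[ac cb].
  set D := d c / E c in cmax.
  have dD r : a <= r <= b -> d r <= D * E r.
    move=> rab; rewrite -ler_pdivrMr ?expR_gt0//.
    by apply: cmax; rewrite in_itv.
  suff D0 : D <= 0.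
    by move=> sab; apply: le_trans (dD s sab) _; rewrite mulr_le0_ge0// expR_ge0.
  have := Kle a c (lexx _) ac cb; rewrite {2}/d xya subrr subr0 => dc.
  have : \int[mu]_(r in `]a, c[) (Num.sqrt (x r) - Num.sqrt (y r)) <=
      \int[mu]_(r in `]a, c[) (D / 2 * (2 * L * E r)).
    apply: le_Rintegral => //.
    - apply: cint => // r; apply: cvgB; exact: csqrt.
    - apply: cint => // r; apply: cvgM; first exact: cvg_cst.
      by apply: cvgM; [exact: cvg_cst|exact: cE].
    - move=> r /=; rewrite in_itv/= => /andP[ar rc].
      have rab : a <= r <= b by rewrite (ltW ar)/= (le_trans (ltW rc)).
      apply: le_trans (_ : _ <= L * d r) _.
        apply: sqrt_lipschitz => //; first exact: mx.
        by rewrite ltW ?y0//= -subr_ge0 d_ge0.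
      by have := dD r rab; nra.
  rewrite RintegralZl//; last first.
    apply: cint => // r.
    by apply: cvgM; [exact: cvg_cst|exact: cE].
  rewrite Rintegral_expR// -/(E c) -/(E a) => h.
  have Ec : 0 < E c by rewrite expR_gt0.
  have Ea : 0 < E a by rewrite expR_gt0.
  have {}h := le_trans dc h.
  have dcE : d c = D * E c by rewrite /D divfK// gt_eqF.
  rewrite leNgt; apply/negP => D0; rewrite dcE in h.
  by have := mulr_gt0 D0 Ec; have := mulr_gt0 D0 Ea; nra.
have xy s : a <= s <= b -> x s = y s.
  move=> sab; apply/eqP; rewrite -subr_eq0 eq_le.
  by rewrite [_ <= 0]d_le0//= [0 <= _]d_ge0.
split=> //.
(* With x = y, [K] over [a, b] says that w - u, nonnegative almost everywhere, has integral 0. *)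
have := K a b (lexx _) (ltW ab) (lexx _).
rewrite /d xya xyb !subrr (@eq_Rintegral _ _ _ _ _ (cst 0)); last first.
  move=> s; rewrite inE/= in_itv/= => /andP[as_ sb].
  by rewrite xy ?subrr// !ltW.
rewrite Rintegral_cst// mul0r sub0r => /esym/eqP; rewrite oppr_eq0 => /eqP wu0.
have := ae_ge0_Rintegral_eq0 _ iwu (wu_ge0 a b (lexx _) (lexx _)) wu0.
move=> /(_ (measurable_itv _)); apply: ae_sub => s h sab.
by apply/esym/eqP; rewrite -subr_eq0 h.
Qed.

End comparison.

(** * Constant residual on one stage *)

Section stage.
Context {R : realType}.
Implicit Types (a b al be c k s h : R) (X : R -> R).

Lemma expRB1_gt0 h : 0 < h -> 0 < expR h - 1.
Proof. by move=> h0; have := expR_ge1Dx h; lra. Qed.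

(** The bounds 0 and h come from [expR_ge1Dx] at h and at - h. In [stage_time], h serves for small
    parameters and 1 for large ones. *)
Lemma expRB1_ratio h : 0 < h -> 0 <= 1 - h / (expR h - 1) <= Num.min 1 h.
Proof.
move=> h0; have e0 := expRB1_gt0 h0.
have e1 : h <= expR h - 1 by have := expR_ge1Dx h; lra.
have e2 : (1 - h) * (expR h - 1) <= h.
  have := expR_ge1Dx (- h); rewrite expRN.
  have eh : 0 < expR h by exact: expR_gt0.
  rewrite -(ler_pM2r eh) mulVf ?gt_eqF// => H.
  by move: H; rewrite mulrDl mul1r; lra.
rewrite le_min subr_ge0 ler_pdivrMr// mul1r e1/=; apply/andP; split.
  by rewrite gerBl divr_ge0// ltW.
by rewrite lerBlDr addrC -lerBlDr ler_pdivlMr.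
Qed.

(** The left-hand side is the elapsed time [2 * (k * (expR th - 1) - c * th)] for
    [k = (be - al) / (expR th - 1)] and [c = k - al], the constants for which the square root goes
    from [al] to [be] as the parameter runs up to [th]. *)
Lemma stage_time al be h : 0 < al -> 0 < h ->
  exists2 th, 0 < th &
    2 * (be - al + al * th) - 2 * (be - al) * (th / (expR th - 1)) = h.
Proof.
move=> al0 h0; set de := be - al.
pose H th := 2 * (de + al * th) - 2 * de * (th / (expR th - 1)).
have de0 : 0 <= `|de| by [].
have dele : - `|de| <= de <= `|de| by rewrite -ler_norml.
(* By [HE] and [expRB1_ratio], H th is at most 2 (al + |de|) th and at least 2 al th - 2 |de|; these
   bounds equal h at [t1] and at [t2]. As [t1] is positive, the singular point 0 is avoided. *)
pose t1 := h / (2 * (al + `|de|)); pose t2 := (h + 2 * `|de|) / (2 * al).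
have t10 : 0 < t1 by rewrite divr_gt0// mulr_gt0// ltr_wpDr.
have t12 : t1 <= t2.
  rewrite /t1 /t2 ler_pdivrMr ?mulr_gt0 ?ltr_wpDr//.
  rewrite -mulrAC ler_pdivlMr ?mulr_gt0//; nra.
have t20 : 0 < t2 by exact: lt_le_trans t12.
have HE th : H th = 2 * al * th + 2 * de * (1 - th / (expR th - 1)).
  by rewrite /H; ring.
have H1 : H t1 <= h.
  rewrite HE; have := expRB1_ratio t10.
  rewrite le_min => /and3P[]; move: (1 - _) => r r0 _ r1.
  have : t1 * (2 * (al + `|de|)) = h.
    by rewrite /t1 divfK// gt_eqF// mulr_gt0// ltr_wpDr.
  by nra.
have H2 : h <= H t2.
  rewrite HE; have := expRB1_ratio t20.
  rewrite le_min => /and3P[]; move: (1 - _) => r r0 r1 _.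
  have : t2 * (2 * al) = h + 2 * `|de|.
    by rewrite /t2 divfK// gt_eqF// mulr_gt0.
  by nra.
have cH : {within `[t1, t2], continuous H}.
  apply: continuous_in_subspaceT => th.
  rewrite inE/= in_itv/= => /andP[t1th _].
  have th0 : 0 < th by exact: lt_le_trans t1th.
  apply: cvgB.
    apply: cvgM; first exact: cvg_cst.
    apply: cvgD; first exact: cvg_cst.
    by apply: cvgM; [exact: cvg_cst|exact: cvg_id].
  apply: cvgM; first exact: cvg_cst.
  apply: cvgM; first exact: cvg_id.
  apply: cvgV; first by rewrite gt_eqF// expRB1_gt0.
  by apply: cvgB; [exact: continuous_expR|exact: cvg_cst].
have [|th] := @IVT _ H t1 t2 h t12 cH.
  by rewrite ge_min le_max H1 H2 orbT.
rewrite in_itv/= => /andP[t1th _] Hth; exists th => //.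
exact: lt_le_trans t1th.
Qed.

Lemma is_derive_affine_comp (e : R -> R) a k c h de : is_derive h 1 e de ->
  is_derive h 1 (fun h => a + (k * (e h - 1) - c * h)) (k * de - c).
Proof.
move=> dE.
have D := is_deriveD (is_derive_cst a h 1) (is_deriveB
  (is_deriveZ k (is_deriveB dE (is_derive_cst (1 : R) h 1)))
  (is_deriveZ c (is_derive_id h 1))).
by apply: (is_derive_eq D); rewrite /GRing.scale/=; ring.
Qed.

(** The positivity of the quotient makes the logarithm genuine: [al + c] has the sign of [be - al],
    so numerator and denominator may both be negative. *)
Lemma stage_solution a b al be : a < b -> 0 < al -> 0 < be -> be != al ->
  exists c X,
  [/\ X a = al ^+ 2, X b = be ^+ 2 & forall s, a <= s <= b -> 0 < X s] /\
  [/\ {within `[a, b], continuous X},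
      forall s, a < s < b -> is_derive s 1 X (Num.sqrt (X s) + c) &
      forall s, a <= s <= b -> 0 < (Num.sqrt (X s) + c) / (al + c) /\
        Num.sqrt (X s) - c * ln ((Num.sqrt (X s) + c) / (al + c)) =
        al + (s - a) / 2].
Proof.
move=> ab al0 be0 beal.
have ba0 : 0 < b - a by rewrite subr_gt0.
have [th th0 thE] := stage_time be al0 ba0.
have eth := expRB1_gt0 th0.
(* This k makes y equal to [be] at [th]; it is nonzero because [be != al]. *)
have [k [k0 kth]] : exists k, k != 0 /\ k * (expR th - 1) = be - al.
  exists ((be - al) / (expR th - 1)); split.
    by rewrite mulf_neq0 ?subr_eq0// invr_eq0 gt_eqF.
  by rewrite divfK// gt_eqF.
have [c cE] : exists c, c = k - al by exists (k - al).
have [y yE] : exists y, forall h, y h = al + k * (expR h - 1).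
  by exists (fun h => al + k * (expR h - 1)).
have [tau tauE] : exists tau, forall h, tau h = a + 2 * (k * (expR h - 1) - c * h).
  by exists (fun h => a + 2 * (k * (expR h - 1) - c * h)).
(* Whatever the sign of k, y h is the convex combination of [al] and [be] with weight l. *)
have y0 h : 0 <= h <= th -> 0 < y h.
  move=> /andP[h0 hth]; pose l := (expR h - 1) / (expR th - 1).
  have l01 : 0 <= l <= 1.
    have h1 : 0 <= expR h - 1 by have := expR_ge1Dx h; lra.
    rewrite /l divr_ge0 ?(ltW eth)//=.
    by rewrite ler_pdivrMr// mul1r lerD2r ler_expR.
  have -> : y h = (1 - l) * al + l * be.
    rewrite yE (_ : k * _ = k * (expR th - 1) * l).
      by rewrite kth; ring.
    by rewrite /l -mulrA (mulrC (expR th - 1)) divfK// gt_eqF.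
  by nra.
have tau0 : tau 0 = a by rewrite tauE expR0; ring.
have tauth : tau th = b.
  have thk : (be - al) * (th / (expR th - 1)) = k * th.
    by rewrite -kth -mulrA (mulrC (expR th - 1)) divfK// gt_eqF.
  by rewrite tauE kth cE; move: thE; rewrite -mulrA thk; lra.
have dtau h : is_derive h 1 tau (2 * y h).
  rewrite (_ : 2 * y h = 2 * k * expR h - 2 * c); last by rewrite yE cE; ring.
  rewrite (_ : tau = fun h => a + (2 * k * (expR h - 1) - 2 * c * h)).
    exact: is_derive_affine_comp.
  by apply: funext => r; rewrite tauE; ring.
have ctau : continuous tau.
  move=> h; apply: differentiable_continuous; rewrite -derivable1_diffP.
  by have [] := dtau h.
have wtau : {within `[0, th], continuous tau} by exact: continuous_subspaceT.
have incr r s : 0 <= r -> r < s -> s <= th -> tau r < tau s.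
  apply: gtr0_derive1_incr => // h; rewrite in_itv/= => /andP[h0 hth].
  rewrite derive1E; have [_ ->] := dtau h.
  by rewrite mulr_gt0// y0// (ltW h0) (ltW hth).
(* The inverse of [tau] from [a, b] to [0, th], with default value 0 elsewhere. *)
pose g s := xget 0 [set h | 0 <= h <= th /\ tau h = s].
have gK : {in `[0, th], cancel tau g}.
  move=> h; rewrite in_itv/= => hth.
  have [] : [set r | 0 <= r <= th /\ tau r = tau h] (g (tau h)).
    by apply: xgetPex; exists h.
  move=> gth; have [lt|gt|//] := ltgtP (g (tau h)) h.
    have := incr _ _ (proj1 (andP gth)) lt (proj2 (andP hth)).
    by move=> /[swap] ->; rewrite ltxx.
  have := incr _ _ (proj1 (andP hth)) gt (proj2 (andP gth)).
  by move=> /[swap] ->; rewrite ltxx.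
have cg : {within `[a, b], continuous g}.
  by rewrite -tau0 -tauth; apply: segment_can_le_continuous => //; exact: ltW.
have gP s : a <= s <= b -> exists2 h, 0 <= h <= th & s = tau h.
  move=> /andP[as_ sb]; have [||h] := @IVT _ tau 0 th s _ wtau; first exact: ltW.
    by rewrite tau0 tauth ge_min le_max as_ sb orbT.
  by rewrite in_itv/= => h0 <-; exists h.
have dy h : is_derive h 1 y (k * expR h).
  rewrite -[k * _]subr0.
  rewrite (_ : y = fun h => al + (k * (expR h - 1) - 0 * h)).
    exact: is_derive_affine_comp.
  by apply: funext => r; rewrite yE mul0r subr0.
have cy : continuous y.
  move=> h; apply: differentiable_continuous; rewrite -derivable1_diffP.
  by have [] := dy h.
exists c, (fun s => y (g s) ^+ 2).
have sqrtX s : a <= s <= b -> Num.sqrt (y (g s) ^+ 2) = y (g s).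
  move=> /gP[h h0 ->]; rewrite gK ?in_itv//= sqrtr_sqr gtr0_norm// y0//.
have yc h : y h + c = k * expR h by rewrite yE cE; ring.
split; split.
- by rewrite -tau0 gK ?in_itv/= ?lexx ?ltW// yE expR0; ring.
- by rewrite -tauth gK ?in_itv/= ?lexx ?ltW// yE kth; ring.
- by move=> s /gP[h h0 ->]; rewrite gK ?in_itv// exprn_gt0// y0.
- move=> s; apply: cvgM; apply: (continuous_comp (cg s)); exact: cy.
- move=> s /andP[as_ sb].
  have sab : a <= s <= b by rewrite (ltW as_) (ltW sb).
  rewrite sqrtX//; have [h /andP[h0 hth] sE] := gP s sab.
  have {}h0 : 0 < h.
    rewrite lt_neqAle h0 andbT; apply/eqP => h0'.
    by move: as_; rewrite sE -h0' tau0 ltxx.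
  have {}hth : h < th.
    rewrite lt_neqAle hth andbT; apply/eqP => h0'.
    by move: sb; rewrite sE h0' tauth ltxx.
  have hin : h \in `]0, th[ by rewrite in_itv/= h0.
  have dg : is_derive s 1 g (2 * y h)^-1.
    rewrite sE; apply: is_derive_inverse => //.
    + near=> r; apply: gK; apply: subset_itv_oo_cc; near: r.
      exact: near_in_itvoo.
    + by near=> r; exact: ctau.
    + by rewrite gt_eqF// mulr_gt0// y0// (ltW h0) (ltW hth).
  have gs : g s = h by rewrite sE gK// subset_itv_oo_cc.
  have dyg : is_derive s 1 (y \o g) (k * expR h * (2 * y h)^-1).
    by apply: is_derive1_comp => //; rewrite gs; exact: dy.
  (* The factor 2 y from the square cancels the derivative 2 y of [tau]: what remains is k e^h = y +
     c. *)
  rewrite gs yc (_ : (fun _ => _) = (y \o g) ^+ 2) //.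
  apply: is_derive_eq; rewrite /GRing.scale/= gs.
  have yh : y h != 0 by rewrite gt_eqF// y0// (ltW h0) (ltW hth).
  by field.
- move=> s sab; rewrite sqrtX//; have [h h0 ->] := gP s sab.
  rewrite gK ?in_itv// yc (_ : al + c = k); last by rewrite cE; ring.
  (* The quotient is exactly e^h, so its logarithm is the parameter h and the equation is the
     formula for [tau]. *)
  rewrite mulrAC divff// mul1r expR_gt0 expRK; split=> //.
  by rewrite tauE yE cE; field.
Unshelve. all: by end_near. Qed.

End stage.

(** * Essential suprema and increments *)

Section Linf_theory.
Context {R : realType}.
Local Notation mu := (@lebesgue_measure R).
Implicit Types (a b c p q s r M : R) (x u v f : R -> R) (D : set R).

(** The norm of exponent [+oo] is an essential supremum under the condition that the whole space has
    positive measure. *)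
Lemma lebesgue_measure_setT_gt0 : (0 < mu [set: R])%E.
Proof.
apply: (@lt_le_trans _ _ (mu `]0, 1[)).
  by rewrite lebesgue_measure_itv/= lte_fin ltr01 oppr0 adde0 lte_fin.
by apply: le_measure; rewrite ?inE.
Qed.

Lemma ae_neq r : \forall s \ae mu, s != r.
Proof.
exists [set r]; split => //; first exact: lebesgue_measure_set1.
by move=> s /= /negP; rewrite negbK => /eqP.
Qed.

(** Outside D the extension by 0 satisfies the bound because [0 <= M]. *)
Lemma Linf_norm_leP D f M : 0 <= M ->
  (Linf_norm D f <= M%:E)%E <-> \forall s \ae mu, D s -> `|f s| <= M.
Proof.
move=> M0; rewrite /Linf_norm unlock lebesgue_measure_setT_gt0.
split.
  move=> /ess_supP; apply: ae_sub => s /= + Ds.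
  by rewrite patchE mem_set.
move=> h; apply/ess_supP; move: h; apply: ae_sub => s /= h.
rewrite patchE; case: ifPn => [/set_mem|_]; last by rewrite normr0 lee_fin.
by rewrite lee_fin.
Qed.

Lemma Linf_norm_ge0 D f : (0 <= Linf_norm D f)%E.
Proof. exact: Lnorm_ge0. Qed.

Lemma Linf_bounded D f M : 0 <= M -> measurable_fun D f ->
  (forall s, D s -> `|f s| <= M) -> Linf D f.
Proof.
move=> M0 mf fM; split=> //; apply: (@le_lt_trans _ _ M%:E); last exact: ltry.
by apply/Linf_norm_leP => //; apply: aeW.
Qed.

Lemma Linf_integrable D f : measurable D -> (mu D < +oo)%E -> Linf D f ->
  mu.-integrable D (EFin \o f).
Proof.
move=> mD muD [mf fy]; apply/integrableP; split; first exact/measurable_EFinP.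
have [M M0 fM] : exists2 M, 0 <= M & \forall s \ae mu, D s -> `|f s| <= M.
  have ffin : Linf_norm D f \is a fin_num by rewrite ge0_fin_numE ?Linf_norm_ge0.
  exists (fine (Linf_norm D f)); first by rewrite fine_ge0 ?Linf_norm_ge0.
  by apply/Linf_norm_leP; rewrite ?fine_ge0 ?Linf_norm_ge0// fineK.
apply: (@le_lt_trans _ _ (\int[mu]_(s in D) M%:E)%E).
  apply: ae_ge0_le_integral => //.
  by do 2 apply: measurableT_comp => //; exact/measurable_EFinP.
rewrite integral_cst//; have [->|M_gt0] := eqVneq M 0; first by rewrite mul0e.
by rewrite lte_mul_pinfty.
Qed.

Lemma Rintegral_itvcc_oo a b f : measurable_fun `]a, b[ f ->
  \int[mu]_(s in `[a, b]) f s = \int[mu]_(s in `]a, b[) f s.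
Proof.
move=> mf; congr fine; apply: (@integral_itv_bndoo _ a b (EFin \o f) true false).
exact/measurable_EFinP.
Qed.

Lemma Rintegral_itvoo_split a b c f : a <= b -> b < c ->
    mu.-integrable `]a, c[ (EFin \o f) ->
  \int[mu]_(s in `]a, c[) f s =
  \int[mu]_(s in `]a, b[) f s + \int[mu]_(s in `]b, c[) f s.
Proof.
move=> ab bc intf; rewrite [X in _ = X + _]Rintegral_itv_bndo_bndc; last first.
  by apply: integrableS intf => //; apply: subset_itvl; rewrite bnd_simp ltW.
rewrite -(@Rintegral_itvB _ f _ _ b intf) ?bnd_simp ?(ltW ab)//.
by rewrite addrC subrK.
Qed.

Lemma ae_itvcc a b (P : R -> Prop) :
  (\forall s \ae mu, `]a, b[%classic s -> P s) ->
  \forall s \ae mu, `[a, b]%classic s -> P s.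
Proof.
have : \forall s \ae mu, s != a /\ s != b.
  by apply: (ae_sub2 _ (ae_neq a) (ae_neq b)).
apply: ae_sub2 => s [sa sb] Ps /=; rewrite in_itv/= => /andP[as_ sb'].
by apply: Ps; rewrite /= in_itv/= !lt_neqAle eq_sym sa as_ sb.
Qed.

Lemma within_subspace_eq (A : set R) x f : {in A, x =1 f} ->
  {within A, continuous f} -> {within A, continuous x}.
Proof.
move=> xf; apply: subspace_eq_continuous => s As.
by rewrite /from_subspace xf.
Qed.

(** Brings classical solutions to the integral form that [weak_derivative_increment] gives for weak
    ones, so that [comparison] can relate the two. *)
Lemma is_derive_increment a b x f : {within `[a, b], continuous x} ->
    {within `[a, b], continuous f} ->
    (forall s, a < s < b -> is_derive s 1 x (f s)) ->
  forall p q, a <= p -> p <= q -> q <= b ->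
  x q - x p = \int[mu]_(s in `]p, q[) f s.
Proof.
move=> cx cf dx p q ap; rewrite le_eqVlt => /predU1P[<- _|pq qb].
  by rewrite set_itv_ge ?bnd_simp ?ltxx// Rintegral_set0 subrr.
have sub : `[p, q] `<=` `[a, b] by apply: subset_itv; rewrite bnd_simp.
have cx' := continuous_subspaceW sub cx.
have cf' := continuous_subspaceW sub cf.
rewrite -Rintegral_itvcc_oo; last first.
  by have /integrable_within_continuous/measurable_int/measurable_EFinP := cf'.
have dx' s : s \in `]p, q[ -> is_derive s 1 x (f s).
  rewrite in_itv/= => /andP[ps sq]; apply: dx.
  by rewrite (le_lt_trans ap ps) (lt_le_trans sq qb).
have [_ xp xq] := (continuous_within_itvP x pq).1 cx'.
rewrite /Rintegral (@continuous_FTC2 _ f x)//.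
- by split => // s /dx'[].
- by move=> s /dx' ds; rewrite derive1E derive_val.
Qed.

End Linf_theory.

(** * Concatenation of the stages *)

Section stage_problem.
Context {R : realType}.
Local Notation mu := (@lebesgue_measure R).
Implicit Types (a b c p q s : R) (x u v X phi : R -> R).

Definition constant_residual a b p q c X :=
  [/\ X a = p, X b = q, (forall s, a <= s <= b -> 0 < X s),
      {within `[a, b], continuous X} &
      forall s, a < s < b -> is_derive s 1 X (Num.sqrt (X s) + c)].

Lemma continuous_sqrt_comp (A : set R) x : {within A, continuous x} ->
  {within A, continuous (fun s => Num.sqrt (x s))}.
Proof. by move=> cx s; apply: (continuous_comp (cx s)); exact: sqrt_continuous. Qed.

Lemma constant_residual_continuous a b p q c X :
  constant_residual a b p q c X ->
  {within `[a, b], continuous (fun s => Num.sqrt (X s) + c)}.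
Proof.
move=> [_ _ _ cX _] s; apply: cvgD; last exact: cvg_cst.
exact: continuous_sqrt_comp.
Qed.

Lemma constant_residual_optimal a b p q c X x u : a < b ->
    constant_residual a b p q c X -> {within `[a, b], continuous x} ->
    (forall s, a <= s <= b -> 0 < x s) -> x a = p -> x b = q ->
    mu.-integrable `]a, b[ (EFin \o u) ->
    (forall r s, a <= r -> r <= s -> s <= b ->
      x s - x r = \int[mu]_(h in `]r, s[) (Num.sqrt (x h) + u h)) ->
    (\forall s \ae mu, `]a, b[%classic s -> `|u s| <= `|c|) ->
  (forall s, a <= s <= b -> x s = X s) /\
  (\forall s \ae mu, `]a, b[%classic s -> u s = c).
Proof.
move=> ab XP cx x0 xa xb iu hx uc.
have [Xa Xb X0 cX dX] := XP.
have hX := is_derive_increment cX (constant_residual_continuous XP) dX.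
have ic : mu.-integrable `]a, b[ (EFin \o cst c).
  by apply: integrable_within_continuous => s; exact: cvg_cst.
have [c0|c0] := leP 0 c.
  apply: (comparison ab cx cX x0 X0 iu ic hx hX); rewrite ?xa ?xb//.
  move: uc; apply: ae_sub => s uc /uc; rewrite (ger0_norm c0).
  exact/le_trans/ler_norm.
(* For c < 0 the roles are exchanged: X has the smaller residual. *)
have [|||xX uX] := comparison ab cX cx X0 x0 ic iu hX hx; rewrite ?xa ?xb//.
  move: uc; apply: ae_sub => s uc /uc; rewrite (ltr0_norm c0) ler_norml opprK.
  by case/andP.
split=> [s /xX -> //|]; move: uX; apply: ae_sub => s uX si.
exact/esym/uX.
Qed.

End stage_problem.

(** * The concatenated trajectory, its feasibility and the minimal stage costs *)

Section piecewise.
Context {R : realType}.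
Local Notation mu := (@lebesgue_measure R).
Variables (N : nat) (t z c : nat -> R) (X : nat -> R -> R).
Hypothesis N_gt0 : (0 < N)%N.
Hypothesis t_incr : forall i, (i < N)%N -> t i < t i.+1.
Hypothesis XP : forall i, (i < N)%N ->
  constant_residual (t i) (t i.+1) (z i) (z i.+1) (c i) (X i).

Let f : R -> R -> R := fun xs _ => Num.sqrt xs.

Lemma node_le i j : (i <= j)%N -> (j <= N)%N -> t i <= t j.
Proof.
elim: j => [|j IH]; first by rewrite leqn0 => /eqP ->.
rewrite leq_eqVlt => /predU1P[-> //|ij jN].
by apply: le_trans (IH ij (ltnW jN)) _; apply/ltW/t_incr.
Qed.

(** The increments of x are integrals of its weak derivative, which equals sqrt x + u almost
    everywhere; [constant_residual_optimal] then applies on the stage. *)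
Lemma feasible_stage x u i : PLinf_feasible N t z f x u -> (i < N)%N ->
    (Linf_norm `[t i, t i.+1] u <= `|c i|%:E)%E ->
  (forall s, t i <= s <= t i.+1 -> x s = X i s) /\
  (\forall s \ae mu, `[t i, t i.+1]%classic s -> u s = c i).
Proof.
move=> [[v [cx xoo voo vx] vE] uoo x_gt0 xz] iN uc.
have t0i : t 0%N <= t i by apply: node_le => //; exact: ltnW.
have tiN : t i.+1 <= t N by exact: node_le.
have muoo p q : (mu `]p, q[ < +oo)%E.
  by rewrite lebesgue_measure_itv/=; case: ifP; rewrite ?ltry// -EFinD ltry.
have iv := Linf_integrable (measurable_itv _) (muoo _ _) voo.
have iu := Linf_integrable (measurable_itv _) (muoo _ _) uoo.
have sub p q : t i <= p -> q <= t i.+1 -> `]p, q[ `<=` `]t 0%N, t N[.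
  by move=> ? ?; apply: subset_itv; rewrite bnd_simp; lra.
have sub' : `[t i, t i.+1] `<=` `[t 0%N, t N].
  by apply: subset_itv; rewrite bnd_simp.
have cx' := continuous_subspaceW sub' cx.
have [||||||xX uX] := constant_residual_optimal (t_incr iN) (XP iN) cx' (u := u).
- move=> s si; apply: x_gt0; rewrite in_itv/=; lra.
- by apply: xz; exact: ltnW.
- exact: xz.
- by apply: integrableS iu => //; exact: sub.
- move=> p q tp pq qt; rewrite (weak_derivative_increment cx iv vx)//; [|lra..].
  apply: ae_eq_Rintegral => //.
  + have [mv _] := voo.
    by apply: measurable_funS mv => //; exact: sub.
  + apply: measurable_funD.
      have cs : {within `[t i, t i.+1], continuous (fun s => Num.sqrt (x s))}.
        exact: continuous_sqrt_comp.
      have /measurable_int/measurable_EFinP ms := integrable_within_continuous cs.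
      by apply: measurable_funS ms => //; apply: subset_itv; rewrite bnd_simp.
    have [mu_ _] := uoo.
    by apply: measurable_funS mu_ => //; exact: sub.
  + move: vE; apply: ae_sub => s vE spq.
    by apply: vE; apply: subset_itv_oo_cc; exact: (sub _ _ tp qt).
- move/Linf_norm_leP : uc => /(_ (normr_ge0 _)); apply: ae_sub => s uc si.
  by apply: uc; exact: subset_itv_oo_cc.
by split => //; exact: ae_itvcc.
Qed.

(* The default 0 is the right index for t 0, which no ]t i, t i.+1] contains. *)
Definition stage_index s := xget 0%N [set i | (i < N)%N /\ t i < s <= t i.+1].

Definition trajectory s := X (stage_index s) s.

Definition control s := c (stage_index s).

Lemma stage_indexE i s : (i < N)%N -> t i < s <= t i.+1 -> stage_index s = i.
Proof.
move=> iN /andP[tis sti].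
have [jN /andP[tjs stj]] :
    [set j | (j < N)%N /\ t j < s <= t j.+1] (stage_index s).
  by apply: xgetPex; exists i; split; rewrite ?tis.
have [ji|ij|//] := ltngtP (stage_index s) i.
  by have := node_le ji (ltnW iN); rewrite leNgt (lt_le_trans tis stj).
by have := node_le ij (ltnW jN); rewrite leNgt (lt_le_trans tjs sti).
Qed.

Lemma stage_index_lt s : (stage_index s < N)%N.
Proof. by rewrite /stage_index; case: xgetP => // i -> [->]. Qed.

(** The left end of a stage is indexed by the previous stage, whose trajectory also takes the value
    [z i] there; at [t 0] the default index is the right one. *)
Lemma trajectory_stage i s : (i < N)%N -> t i <= s <= t i.+1 ->
  trajectory s = X i s.
Proof.
move=> iN /andP[]; rewrite le_eqVlt => /predU1P[<- _|tis sti]; last first.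
  by rewrite /trajectory (stage_indexE iN) ?tis.
case: i iN => [|i] iN; last first.
  have iN' := ltnW iN.
  rewrite /trajectory (stage_indexE iN') ?t_incr ?lexx//.
  by have [_ -> _ _ _] := XP iN'; have [-> _ _ _ _] := XP iN.
rewrite /trajectory /stage_index xgetPN// => j /= [jN].
by rewrite ltNge (node_le (leq0n j) (ltnW jN)).
Qed.

Lemma trajectory_node i : (i <= N)%N -> trajectory (t i) = z i.
Proof.
case: i => [_|i iN].
  by rewrite (trajectory_stage N_gt0) ?lexx ?ltW ?t_incr//; have [] := XP N_gt0.
by rewrite (trajectory_stage iN) ?lexx ?ltW ?t_incr//; have [] := XP iN.
Qed.

Lemma stage_cover n s : t 0%N <= s <= t n.+1 ->
  exists2 i, (i <= n)%N & t i <= s <= t i.+1.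
Proof.
elim: n => [|n IH] /andP[t0s stn]; first by exists 0%N => //; rewrite t0s.
have [snt|/ltW tns] := leP s (t n.+1); last by exists n.+1 => //; rewrite tns.
have [|i iN si] := IH; first by rewrite t0s.
by exists i => //; exact: leqW.
Qed.

Lemma trajectory_gt0 s : t 0%N <= s <= t N -> 0 < trajectory s.
Proof.
rewrite -{1}(prednK N_gt0) => /stage_cover[i]; rewrite -ltnS prednK// => iN si.
by rewrite (trajectory_stage iN si); have [_ _ ->] := XP iN.
Qed.

Lemma trajectory_continuous n : (n <= N)%N ->
  {within `[t 0%N, t n], continuous trajectory}.
Proof.
elim: n => [_|n IH nN]; first by rewrite set_itv1; exact: continuous_subspace1.
rewrite (_ : `[t 0%N, t n.+1]%classic = `[t 0%N, t n] `|` `[t n, t n.+1]).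
  apply: withinU_continuous; [exact: interval_closed..|exact/IH/ltnW|].
  have [_ _ _ + _] := XP nN; apply: within_subspace_eq => s.
  by rewrite inE/= in_itv/=; exact: trajectory_stage.
apply/seteqP; split=> s /=; rewrite !in_itv/=.
  by move=> /andP[-> ->]; rewrite andbT/=; apply/orP/le_total.
have t0n := node_le (leq0n n) (ltnW nN); have tn := t_incr nN.
by move=> [] h; lra.
Qed.

Lemma measurable_control n : (n <= N)%N ->
  measurable_fun `]t 0%N, t n] control.
Proof.
elim: n => [_|n IH nN].
  by rewrite set_itv_ge ?bnd_simp ?ltxx//; exact: measurable_fun_set0.
rewrite (@itv_bndbnd_setU _ _ _ (BRight (t n))) ?bnd_simp; last 2 first.
- by rewrite node_le// ltnW.
- by rewrite ltW// t_incr.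
apply/measurable_funU => //; split; first exact: IH (ltnW nN).
apply: (@eq_measurable_fun _ _ _ _ _ (cst (c n))) => // s.
by rewrite inE/= in_itv/= => /(stage_indexE nN); rewrite /control => ->.
Qed.

(** The bound is global because [stage_index] is below N everywhere, its default included. *)
Lemma control_bounded : exists2 M, 0 <= M & forall s, `|control s| <= M.
Proof.
exists (\big[Num.max/0]_(i < N) `|c i|); first exact: bigmax_ge_id.
move=> s; rewrite /control.
exact: (le_bigmax _ (fun i : 'I_N => `|c i|) (Ordinal (stage_index_lt s))).
Qed.

Let velocity s := Num.sqrt (trajectory s) + control s.

Lemma measurable_velocity n : (n <= N)%N ->
  measurable_fun `]t 0%N, t n[ velocity.
Proof.
move=> nN; apply: measurable_funD.
  have cs := continuous_sqrt_comp (trajectory_continuous nN).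
  by have /measurable_int/measurable_EFinP := integrable_within_continuous cs.
apply: measurable_funS (measurable_control nN) => //.
by apply: subset_itv; rewrite bnd_simp.
Qed.

Lemma velocity_bounded : exists2 M, 0 <= M &
  forall s, t 0%N <= s <= t N -> `|trajectory s| <= M /\ `|velocity s| <= M.
Proof.
have [M M0 cM] := control_bounded.
have [x xI xmax] := EVT_max (node_le (leq0n N) (leqnn N))
  (trajectory_continuous (leqnn N)).
have x0 : 0 < trajectory x by apply: trajectory_gt0; rewrite in_itv in xI.
exists (trajectory x + Num.sqrt (trajectory x) + M).
  by rewrite !addr_ge0// ?sqrtr_ge0// ltW.
move=> s sI; have s0 := trajectory_gt0 sI.
have sx : trajectory s <= trajectory x by apply: xmax; rewrite in_itv.
have qx := sqrtr_ge0 (trajectory x).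
have qs : Num.sqrt (trajectory s) <= Num.sqrt (trajectory x) by rewrite ler_wsqrtr.
split; first by rewrite gtr0_norm//; lra.
apply: le_trans (ler_normD _ _) _; rewrite ger0_norm ?sqrtr_ge0//.
by have := cM s; lra.
Qed.

(** Induction on the stages: each one is integrated by parts classically, and the boundary terms at
    inner nodes cancel, as adjacent pieces agree there. Boundary terms are kept because phi need not
    vanish at [t n]. *)
Lemma velocity_by_parts (phi : R -> R) n : (n <= N)%N ->
    (forall s, derivable phi s 1) -> continuous (derive1 phi) ->
  \int[mu]_(s in `]t 0%N, t n[) (trajectory s * derive1 phi s) =
  trajectory (t n) * phi (t n) - trajectory (t 0%N) * phi (t 0%N) -
  \int[mu]_(s in `]t 0%N, t n[) (velocity s * phi s).
Proof.
move=> + dphi cdphi; elim: n => [_|n IH nN].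
  by rewrite set_itv_ge ?bnd_simp ?ltxx// !Rintegral_set0 !subrr.
have cphi : continuous phi.
  by move=> s; apply: differentiable_continuous; rewrite -derivable1_diffP.
have t0n : t 0%N <= t n by apply: node_le => //; exact: ltnW.
have tn := t_incr nN.
have ixd : mu.-integrable `]t 0%N, t n.+1[
    (EFin \o (fun s => trajectory s * derive1 phi s)).
  apply: integrable_within_continuous => s.
  apply: cvgM; first exact: trajectory_continuous.
  exact/continuous_subspaceT/cdphi.
have [M M0 vM] := velocity_bounded.
have ivp : mu.-integrable `]t 0%N, t n.+1[ (EFin \o (fun s => velocity s * phi s)).
  apply: (@integrableMr _ _ _ mu _ _ velocity (EFin \o phi)) => //.
  - exact: measurable_velocity.
  - exists M; split; first exact: num_real.
    move=> K MK s /=; rewrite in_itv/= => /andP[ts st]; apply: le_trans (ltW MK).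
    by apply: (vM s _).2; rewrite ltW//= (le_trans (ltW st))// node_le.
  - by apply: integrable_within_continuous; exact/continuous_subspaceT/cphi.
rewrite (Rintegral_itvoo_split t0n tn ixd) (Rintegral_itvoo_split t0n tn ivp).
rewrite (IH (ltnW nN)).
have [Xn Xn1 _ cX dX] := XP nN.
have cv := constant_residual_continuous (XP nN).
have onstage s : s \in `]t n, t n.+1[%classic ->
    trajectory s = X n s /\ velocity s = Num.sqrt (X n s) + c n.
  rewrite inE/= in_itv/= => /andP[ns sn].
  rewrite /velocity /control (stage_indexE nN) ?ns ?ltW//.
  by rewrite (trajectory_stage nN)// !ltW.
have -> : \int[mu]_(s in `]t n, t n.+1[) (trajectory s * derive1 phi s) =
    \int[mu]_(s in `[t n, t n.+1]) (X n s * derive1 phi s).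
  rewrite Rintegral_itvcc_oo.
    by apply: eq_Rintegral => s /onstage[-> _].
  have /integrable_within_continuous/measurable_int/measurable_EFinP// :
    {within `[t n, t n.+1], continuous (fun s => X n s * derive1 phi s)}.
  move=> s; apply: cvgM; first exact: cX.
  exact/continuous_subspaceT/cdphi.
have -> : \int[mu]_(s in `]t n, t n.+1[) (velocity s * phi s) =
    \int[mu]_(s in `[t n, t n.+1]) ((Num.sqrt (X n s) + c n) * phi s).
  rewrite Rintegral_itvcc_oo.
    by apply: eq_Rintegral => s /onstage[_ ->].
  have /integrable_within_continuous/measurable_int/measurable_EFinP// :
    {within `[t n, t n.+1], continuous (fun s => (Num.sqrt (X n s) + c n) * phi s)}.
  move=> s; apply: cvgM; first exact: cv.
  exact/continuous_subspaceT/cphi.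
have [_ Xl Xr] := (continuous_within_itvP (X n) tn).1 cX.
have DX : derivable_oo_LRcontinuous (X n) (t n) (t n.+1).
  by split => // s; rewrite in_itv/= => /dX[].
have EX : {in `]t n, t n.+1[, derive1 (X n) =1 (fun s => Num.sqrt (X n s) + c n)}.
  by move=> s; rewrite in_itv/= => /dX ds; rewrite derive1E derive_val.
have Dphi : derivable_oo_LRcontinuous phi (t n) (t n.+1).
  by split => //; [exact/cvg_at_right_filter/cphi|exact/cvg_at_left_filter/cphi].
have cdphi' : {within `[t n, t n.+1], continuous (derive1 phi)}.
  exact: continuous_subspaceT.
rewrite (Rintegration_by_parts tn cv DX EX cdphi' Dphi (fun _ _ => erefl)).
rewrite (trajectory_node nN) (trajectory_node (ltnW nN)) Xn Xn1; ring.
Qed.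

Lemma trajectory_feasible : PLinf_feasible N t z f trajectory control.
Proof.
have [M M0 vM] := velocity_bounded.
have sub : `]t 0%N, t N[ `<=` `[t 0%N, t N] by exact: subset_itv_oo_cc.
have ct := trajectory_continuous (leqnn N).
split.
- exists velocity; last by apply: aeW.
  split => //.
  + apply: (Linf_bounded M0).
      by have /measurable_int/measurable_EFinP := integrable_within_continuous ct.
    by move=> s /sub; rewrite /= in_itv/= => /vM[].
  + apply: (Linf_bounded M0); first exact: measurable_velocity.
    by move=> s /sub; rewrite /= in_itv/= => /vM[].
  + move=> phi [dphi cdphi _ supp].
    (* The support of phi lies in the open interval, so both boundary terms of [velocity_by_parts]
       vanish. *)
    have phi0 s : ~ `]t 0%N, t N[%classic s -> phi s = 0.
      move=> ns; apply/eqP/negPn/negP => phis; apply: ns.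
      exact/supp/subset_closure.
    rewrite (velocity_by_parts (leqnn N) dphi cdphi).
    rewrite (phi0 (t N)) ?(phi0 (t 0%N)); first by rewrite !mulr0 subrr sub0r.
      by rewrite /= in_itv/= ltxx.
    by rewrite /= in_itv/= ltxx andbF.
- have [K K0 cK] := control_bounded.
  apply: (Linf_bounded K0) => //.
  apply: measurable_funS (measurable_control (leqnn N)) => //.
  by apply: subset_itv; rewrite bnd_simp.
- by move=> s; rewrite in_itv/=; exact: trajectory_gt0.
- exact: trajectory_node.
Qed.

Lemma control_cost i : (i < N)%N -> (Linf_norm `[t i, t i.+1] control <= `|c i|%:E)%E.
Proof.
move=> iN; apply/Linf_norm_leP => //; apply/ae_itvcc/aeW => s /=.
rewrite in_itv/= => /andP[tis sti].
by rewrite /control (stage_indexE iN)// tis ltW.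
Qed.

(** A smaller cost would, by [feasible_stage], force u = c i almost everywhere on the stage, where
    |u| would also stay strictly below |c i|. *)
Lemma stage_cost_ge x u i : PLinf_feasible N t z f x u -> (i < N)%N ->
  (`|c i|%:E <= Linf_norm `[t i, t i.+1] u)%E.
Proof.
move=> xu iN; rewrite leNgt; apply/negP => lt.
have [_ uc] := feasible_stage xu iN (ltW lt).
have ufin : Linf_norm `[t i, t i.+1] u \is a fin_num.
  by rewrite ge0_fin_numE ?Linf_norm_ge0// (lt_le_trans lt)// leey.
move: lt; rewrite -(fineK ufin) lte_fin; set m := fine _ => lt.
have m0 : 0 <= m by rewrite fine_ge0// Linf_norm_ge0.
have um : (Linf_norm `[t i, t i.+1] u <= m%:E)%E by rewrite /m fineK.
move/(Linf_norm_leP _ _ m0) : um => um.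
(* No point of the stage can satisfy both conditions, so the stage would be a null set, against
   [t i < t i.+1]. *)
have [N0 [mN0 N00 sN]] : \forall s \ae mu, ~ (`[t i, t i.+1]%classic s).
  move: uc um; apply: ae_sub2 => s uc um si.
  by have := um si; rewrite (uc si) leNgt lt.
have : (mu `[t i, t i.+1] <= mu N0)%E.
  apply: le_measure; rewrite ?inE// => s si; apply: sN => /=.
  by move=> /(_ si).
rewrite N00 lebesgue_measure_itv/= lte_fin t_incr// -EFinB lee_fin subr_le0.
by rewrite leNgt t_incr.
Qed.

End piecewise.

(** * Existence of a solution and uniqueness on each stage *)

Section optimality.
Context {R : realType}.
Variables (N : nat) (t z c : nat -> R) (X : nat -> R -> R).
Hypothesis N_gt0 : (0 < N)%N.
Hypothesis t_incr : forall i, (i < N)%N -> t i < t i.+1.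
Hypothesis XP : forall i, (i < N)%N ->
  constant_residual (t i) (t i.+1) (z i) (z i.+1) (c i) (X i).

Lemma control_optimal :
  PLinf_solution N t z (fun xs _ => Num.sqrt xs) (trajectory N t X) (control N t c).
Proof.
split; first exact: trajectory_feasible.
move=> x u xu; apply: lee_sum => i _.
exact: (le_trans (control_cost c t_incr (ltn_ord i))
  (stage_cost_ge t_incr XP xu (ltn_ord i))).
Qed.

(** The total cost of u is at most that of the concatenation, while no stage cost of u is below the
    minimum. Cancelling the other stages leaves the bound |c i| on stage i. *)
Lemma solution_stage x u i :
    PLinf_solution N t z (fun xs _ => Num.sqrt xs) x u -> (i < N)%N ->
  (forall s, t i <= s <= t i.+1 -> x s = X i s) /\
  (\forall s \ae @lebesgue_measure R, `[t i, t i.+1]%classic s -> u s = c i).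
Proof.
move=> [xu opt] iN; apply: (feasible_stage t_incr XP xu iN).
have := opt _ _ (trajectory_feasible N_gt0 t_incr XP).
rewrite /PLinf_cost (bigD1 (Ordinal iN))//= [leRHS](bigD1 (Ordinal iN))//=.
set S := (\sum_(_ < _ | _) _)%E; set S' := (\sum_(_ < _ | _) _)%E => le.
have S'S : (S' <= S)%E.
  apply: lee_sum => j _.
  exact: (le_trans (control_cost c t_incr (ltn_ord j))
    (stage_cost_ge t_incr XP xu (ltn_ord j))).
(* In the extended reals only a finite term may be cancelled. *)
have S'fin : S' \is a fin_num.
  apply/sum_fin_numP => j _ _; rewrite ge0_fin_numE ?Linf_norm_ge0//.
  exact: le_lt_trans (control_cost c t_incr (ltn_ord j)) (ltry _).
rewrite -(leeD2rE _ _ S'fin); apply: (le_trans (leeD2l _ S'S)).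
by apply: le_trans le _; apply: leeD => //; exact: control_cost.
Qed.

End optimality.

Theorem proposition5 (R : realType) (N : nat) (t z : nat -> R)
    (N_gt0 : (0 < N)%N)
    (t_0 : t 0%N = 0)
    (t_incr : forall i, (i < N)%N -> t i < t i.+1)
    (z_0 : z 0%N = 1)
    (z_gt0 : forall i, (i <= N)%N -> 0 < z i)
    (z_neq : forall i, (i < N)%N -> z i.+1 != z i) :
  exists ubar : nat -> R,
    (forall i, (i < N)%N ->
      0 < (Num.sqrt (z i.+1) + ubar i.+1) / (Num.sqrt (z i) + ubar i.+1) /\
      ubar i.+1 *
        ln ((Num.sqrt (z i.+1) + ubar i.+1) / (Num.sqrt (z i) + ubar i.+1)) =
      Num.sqrt (z i.+1) - Num.sqrt (z i) - (t i.+1 - t i) / 2) /\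
    (exists x u : R -> R,
      PLinf_solution N t z (fun xs _ => Num.sqrt xs) x u) /\
    (forall x u : R -> R,
      PLinf_solution N t z (fun xs _ => Num.sqrt xs) x u ->
      forall i, (i < N)%N ->
        (\forall s \ae @lebesgue_measure R,
          s \in `[t i, t i.+1] -> u s = ubar i.+1) /\
        forall s, s \in `[t i, t i.+1] ->
          0 < (Num.sqrt (x s) + ubar i.+1) / (Num.sqrt (z i) + ubar i.+1) /\
          Num.sqrt (x s) -
            ubar i.+1 *
              ln ((Num.sqrt (x s) + ubar i.+1) / (Num.sqrt (z i) + ubar i.+1)) =
          Num.sqrt (z i) + (s - t i) / 2).
Proof.
have stage i : exists cX : R * (R -> R), (i < N)%N ->
    constant_residual (t i) (t i.+1) (z i) (z i.+1) cX.1 cX.2 /\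
    forall s, t i <= s <= t i.+1 ->
      0 < (Num.sqrt (cX.2 s) + cX.1) / (Num.sqrt (z i) + cX.1) /\
      Num.sqrt (cX.2 s) -
        cX.1 * ln ((Num.sqrt (cX.2 s) + cX.1) / (Num.sqrt (z i) + cX.1)) =
      Num.sqrt (z i) + (s - t i) / 2.
  (* [choice] asks for a pair at every index; past the last stage any pair will do. *)
  case: (boolP (i < N)%N) => [iN|_]; last by exists (0, id).
  have zi := z_gt0 _ (ltnW iN); have zi1 := z_gt0 _ iN.
  have [|||c [X [[Xa Xb X0] [cX dX XE]]]] := @stage_solution R (t i) (t i.+1)
    (Num.sqrt (z i)) (Num.sqrt (z i.+1)) (t_incr _ iN).
  - by rewrite sqrtr_gt0.
  - by rewrite sqrtr_gt0.
  - by rewrite eqr_sqrt ?z_neq// ltW.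
  exists (c, X) => _; split=> //.
  by split => //=; rewrite ?Xa ?Xb sqr_sqrtr// ltW.
have [cX cXP] := choice stage.
pose c i := (cX i).1; pose X i := (cX i).2.
have XP i : (i < N)%N ->
    constant_residual (t i) (t i.+1) (z i) (z i.+1) (c i) (X i).
  by move=> /cXP[].
(* The stages are numbered from 0 in [c] and from 1 in the statement. *)
exists (fun i => c i.-1); split; [|split].
- move=> i iN; have [[_ Xb _ _ _] XE] := cXP i iN.
  (* The equation for the residual is the implicit equation of the trajectory at the right end of
     the stage. *)
  have [|] := XE (t i.+1); first by rewrite lexx andbT ltW ?t_incr.
  by rewrite Xb => ? ?; split => //=; rewrite /c; lra.
- exists (trajectory N t X), (control N t c).
  exact: control_optimal.
- move=> x u xu i iN; have [xX uc] := solution_stage N_gt0 t_incr XP xu iN.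
  split=> // s; rewrite in_itv/= => si.
  by rewrite xX//; have [_] := cXP i iN; exact.
Qed.
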